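(* Let $\Psi$ be a connected, non-bipartite complex unit gain graph on $n$ vertices whose underlying graph $\Gamma(\Psi)$ is asymmetric (has no non-trivial automorphism), let $A=A(\Psi)$, and let $z\in\mathbb{T}\setminus\mathbb{T}_4$. Let $\breve{\Psi}$ be the gain graph on $2n$ vertices with gain matrix \[A(\breve{\Psi})=\begin{bmatrix}A & A+zI\\ A+\bar{z}I & -A\end{bmatrix}.\] Then $\breve{\Psi}$ is sign-symmetric if and only if $\Psi$ is switching equivalent to a signed graph, i.e., if and only if there is a diagonal matrix $X$ with diagonal entries in $\mathbb{T}$ such that all entries of $XAX^{-1}$ lie in $\{-1,0,1\}$.
   Context: $\mathbb{T}=\{z\in\mathbb{C}:|z|=1\}$ and $\mathbb{T}_4=\{z\in\mathbb{C}: z^4=1\}=\{\pm1,\pm i\}$. A complex unit gain graph $\Psi=(G,\psi)$ consists of a finite simple graph $G$ (its underlying graph, written $\Gamma(\Psi)=G$) with vertex set $\{1,\dots,n\}$ and a map $\psi$ assigning to each ordered pair $(u,v)$ with $uv$ an edge a value $\psi(uv)\in\mathbb{T}$, with $\psi(vu)=\psi(uv)^{-1}$. Its gain matrix $A(\Psi)$ is the Hermitian $n\times n$ matrix with $A_{uv}=\psi(uv)$ if $uv$ is an edge and $A_{uv}=0$ otherwise; conversely any Hermitian matrix with zero diagonal and entries in $\mathbb{T}\cup\{0\}$ is the gain matrix of a unique gain graph. The negation of $\Psi$ is $-\Psi=(G,-\psi)$. Two gain graphs are switching isomorphic ($\Psi\sim\Psi'$) if $A(\Psi')$ can be obtained from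 $A(\Psi)$ by a diagonal switching $A\mapsto XAX^{-1}$ ($X$ diagonal with diagonal entries in $\mathbb{T}$), possibly followed by taking the converse (replacing every gain by its inverse, i.e. $A\mapsto \overline{A}=A^\top$) and/or relabeling the vertices ($A\mapsto PAP^{-1}$ with $P$ a permutation matrix). $\Psi$ is sign-symmetric if $\Psi\sim-\Psi$. A signed graph is a gain graph all of whose gains are in $\{\pm1\}$. *)

(* Defs.v *)
From HB Require Import structures.
From mathcomp Require Import all_boot all_order all_algebra all_fingroup.
From mathcomp Require Import reals complex.

Set Implicit Arguments.
Unset Strict Implicit.
Unset Printing Implicit Defensive.

Import Order.TTheory GRing.Theory Num.Theory.

Local Open Scope ring_scope.

Record sgraph (n : nat) := SGraph {
  adj : rel 'I_n;
  adj_sym : symmetric adj;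
  adj_irr : irreflexive adj }.

Definition connected n (G : sgraph n) : Prop :=
  forall u v : 'I_n, connect (adj G) u v.

Definition bipartite n (G : sgraph n) : Prop :=
  exists c : 'I_n -> bool, forall u v, adj G u v -> c u != c v.

Definition automorphism n (G : sgraph n) (s : 'S_n) : Prop :=
  forall u v, adj G (s u) (s v) = adj G u v.

Definition asymmetric n (G : sgraph n) : Prop :=
  forall s : 'S_n, automorphism G s -> s = 1%g.

(* Only the values of [gain] on edges are meaningful; its values elsewhere are
   unconstrained, and nothing below depends on them. *)
Record gain_graph (R : realType) (n : nat) := GainGraph {
  underlying : sgraph n;
  gain : 'I_n -> 'I_n -> R[i];
  gain_norm1 : forall u v, adj underlying u v -> `|gain u v| = 1;
  gainV : forall u v, adj underlying u v -> gain v u = (gain u v)^-1 }.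

Section GainGraphs.
Variable R : realType.
Implicit Types (n : nat) (z : R[i]).

Definition gain_mx n (Psi : gain_graph R n) : 'M[R[i]]_n :=
  \matrix_(u, v) if adj (underlying Psi) u v then gain Psi u v else 0.

Definition conj_mx n (A : 'M[R[i]]_n) : 'M[R[i]]_n := map_mx Num.conj A.

Definition is_gain_mx n (A : 'M[R[i]]_n) : Prop :=
  [/\ A^T = conj_mx A,
      forall u, A u u = 0
    & forall u v, A u v = 0 \/ `|A u v| = 1].

Section OfMatrix.
Variables (n : nat) (A : 'M[R[i]]_n) (hA : is_gain_mx A).

Let rA : rel 'I_n := fun u v => A u v != 0.

Lemma mx_conjE u v : A v u = Num.conj (A u v).
Proof. by case: hA => /matrixP/(_ u v); rewrite !mxE. Qed.

Lemma mx_adj_sym : symmetric rA.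
Proof. by move=> u v; rewrite /rA (mx_conjE v u) conjC_eq0. Qed.

Lemma mx_adj_irr : irreflexive rA.
Proof. by case: hA => _ h _ u; rewrite /rA h eqxx. Qed.

Definition sgraph_of_mx := SGraph mx_adj_sym mx_adj_irr.

Lemma mx_norm1 u v : adj sgraph_of_mx u v -> `|A u v| = 1.
Proof.
rewrite /= /rA; case: hA => _ _ /(_ u v) [-> | //]; by rewrite eqxx.
Qed.

Lemma mx_gainV u v : adj sgraph_of_mx u v -> A v u = (A u v)^-1.
Proof.
by move=> /mx_norm1 h; rewrite invC_norm h expr1n invr1 mul1r -mx_conjE.
Qed.

Definition gain_graph_of_mx : gain_graph R n := GainGraph mx_norm1 mx_gainV.

Lemma gain_mx_of_mx : gain_mx gain_graph_of_mx = A.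
Proof.
by apply/matrixP => u v; rewrite mxE /= /rA; case: eqP => [->|].
Qed.

End OfMatrix.

Lemma gain_mxP n (Psi : gain_graph R n) : is_gain_mx (gain_mx Psi).
Proof.
split=> [|u|u v]; last by rewrite mxE; case: ifP => h; [right; exact: gain_norm1|left].
- apply/matrixP => u v; rewrite !mxE adj_sym; case: ifP => h; last by rewrite conjC0.
  by rewrite (gainV h) invC_norm (gain_norm1 h) expr1n invr1 mul1r.
- by rewrite mxE adj_irr.
Qed.

Section Negation.
Variables (n : nat) (Psi : gain_graph R n).

Lemma neg_norm1 u v : adj (underlying Psi) u v -> `|- gain Psi u v| = 1.
Proof. by rewrite normrN; exact: gain_norm1. Qed.

Lemma neg_gainV u v :
  adj (underlying Psi) u v -> - gain Psi v u = (- gain Psi u v)^-1.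
Proof. by move=> h; rewrite invrN (gainV h). Qed.

Definition neg_gain_graph : gain_graph R n := GainGraph neg_norm1 neg_gainV.

End Negation.

Definition is_switching_mx n (X : 'M[R[i]]_n) : Prop :=
  is_diag_mx X /\ forall u, `|X u u| = 1.

Definition switch_mx n (X A : 'M[R[i]]_n) : 'M[R[i]]_n := X *m A *m invmx X.

Definition switching_equivalent n (Psi Psi' : gain_graph R n) : Prop :=
  exists2 X, is_switching_mx X & gain_mx Psi' = switch_mx X (gain_mx Psi).

(* [b] tells whether the converse is taken. *)
Definition switching_isomorphic n (Psi Psi' : gain_graph R n) : Prop :=
  exists (X : 'M[R[i]]_n) (b : bool) (s : 'S_n),
    is_switching_mx X /\
    let B := switch_mx X (gain_mx Psi) in
    let C := if b then conj_mx B else B in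
    gain_mx Psi' = perm_mx s *m C *m invmx (perm_mx s).

Definition sign_symmetric n (Psi : gain_graph R n) : Prop :=
  switching_isomorphic Psi (neg_gain_graph Psi).

Definition signed_graph n (Psi : gain_graph R n) : Prop :=
  forall u v, adj (underlying Psi) u v ->
    gain Psi u v = 1 \/ gain Psi u v = -1.

Definition breve_mx n (A : 'M[R[i]]_n) z : 'M[R[i]]_(n + n) :=
  block_mx A (A + z%:M) (A + (Num.conj z)%:M) (- A).

Lemma breve_mxP n (A : 'M[R[i]]_n) z :
  is_gain_mx A -> `|z| = 1 -> is_gain_mx (breve_mx A z).
Proof.
move=> [hT h0 h1] hz.
have hD w u v : `|w| = 1 ->
    (A + w%:M) u v = 0 \/ `|(A + w%:M) u v| = 1.
  move=> hw; rewrite !mxE; case: eqP => [<-|_]; last by rewrite mulr0n addr0.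
  by right; rewrite h0 add0r mulr1n.
split.
- rewrite /breve_mx /conj_mx tr_block_mx map_block_mx !linearD /= !tr_scalar_mx.
  rewrite linearN /= hT /conj_mx.
  congr block_mx; apply/matrixP => u v; rewrite !mxE.
  + by rewrite rmorphD rmorphMn.
  + by rewrite rmorphD rmorphMn /= conjCK.
  + by rewrite rmorphN.
- move=> u; rewrite -(splitK u); case: (split u) => i /=.
  + by rewrite block_mxEul.
  + by rewrite block_mxEdr mxE h0 oppr0.
- move=> u v; rewrite -(splitK u) -(splitK v).
  case: (split u) => i; case: (split v) => j /=.
  + by rewrite block_mxEul.
  + by rewrite block_mxEur; exact: hD.
  + by rewrite block_mxEdl; apply: hD; rewrite norm_conjC.
  + rewrite block_mxEdr mxE normrN; case: (h1 i j) => [->|]; last by right.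
    by left; rewrite oppr0.
Qed.

Definition breve n (Psi : gain_graph R n) z (hz : `|z| = 1) :
    gain_graph R (n + n) :=
  gain_graph_of_mx (breve_mxP (gain_mxP Psi) hz).

Lemma gain_mx_breve n (Psi : gain_graph R n) z (hz : `|z| = 1) :
  gain_mx (breve Psi hz) = breve_mx (gain_mx Psi) z.
Proof. exact: gain_mx_of_mx. Qed.

Lemma gain_mx_neg n (Psi : gain_graph R n) :
  gain_mx (neg_gain_graph Psi) = - gain_mx Psi.
Proof. by apply/matrixP => u v; rewrite !mxE /=; case: ifP; rewrite ?oppr0. Qed.

End GainGraphs.

(* Main.v *)
(* In the underlying graph of [breve Psi] the two copies of a vertex of [Psi]
   are closed twins, and as an asymmetric graph has no closed twins, every
   automorphism fixes each pair of copies. A switching isomorphism onto the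
   negation therefore sends the copy [i] of [u] to the copy [i (+) e u]; write
   [y] for its switching function. Comparing gains along the edges between the
   copies of [u] and the copies of a neighbour [v] gives
   [y (u, 0) = (-1) ^ e v * y (u, 1)], and comparing them along the edge joining
   both copies of [u] then forces, as [z ^ 4 <> 1], that the converse is taken
   and that [e u = e v = 1]. What is left is [A u v ^ 2 = y (u, 0) / y (v, 0)],
   so switching by [1 / sqrt (y (-, 0))] makes [A] real. Conversely, if [A] is
   real, taking the converse, swapping the copies and switching one of them by
   [-1] maps [breve Psi] to its negation. *)

Require Import Defs.
From HB Require Import structures.
From mathcomp Require Import all_boot all_order all_algebra all_fingroup.
From mathcomp Require Import reals complex.
From mathcomp Require Import ring.

Set Implicit Arguments.
Unset Strict Implicit.
Unset Printing Implicit Defensive.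

Import Order.TTheory GRing.Theory Num.Theory.

Local Open Scope ring_scope.

(** * Closed neighbourhoods and closed twins *)

Section Graphs.
Variables (n : nat) (G : sgraph n).

Definition closed_adj (u v : 'I_n) := (u == v) || adj G u v.

Lemma adj_closed_adj u v : adj G u v = (u != v) && closed_adj u v.
Proof. by rewrite /closed_adj; case: eqVneq => [->|] //=; rewrite adj_irr. Qed.

Lemma closed_adj_sym u v : closed_adj u v = closed_adj v u.
Proof. by rewrite /closed_adj eq_sym adj_sym. Qed.

(** The transposition of two closed twins is an automorphism. *)
Lemma asymmetric_closed_twin_free u v :
  asymmetric G -> closed_adj u =1 closed_adj v -> u = v.
Proof.
move=> hG huv.
have tE x w : closed_adj (tperm u v x) w = closed_adj x w.
  by case: tpermP => [->|->|] //; rewrite huv.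
have /hG h : automorphism G (tperm u v).
  move=> x w; rewrite !adj_closed_adj (inj_eq perm_inj) tE.
  by rewrite closed_adj_sym tE closed_adj_sym.
by rewrite -[LHS](perm1 u) -h tpermL.
Qed.

End Graphs.

(** * Permutations of the doubled vertex set *)

Definition copy n (u : 'I_n) (i : bool) : 'I_(n + n) :=
  if i then rshift n u else lshift n u.
Arguments copy : simpl never.

Section Copies.
Context {n : nat}.

Definition base (a : 'I_(n + n)) : 'I_n :=
  match split a with inl u => u | inr u => u end.

Definition layer (a : 'I_(n + n)) : bool :=
  if split a is inr _ then true else false.

Lemma copyK a : copy (base a) (layer a) = a.
Proof. by rewrite -[RHS]splitK /copy /base /layer; case: split. Qed.

Lemma copy_base u i : base (copy u i) = u.
Proof.
rewrite /base /copy; case: i; last by rewrite -/(unsplit (inl u)) unsplitK.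
by rewrite -/(unsplit (inr u)) unsplitK.
Qed.

Lemma copy_layer (u : 'I_n) i : layer (copy u i) = i.
Proof.
rewrite /layer /copy; case: i; last by rewrite -/(unsplit (inl u)) unsplitK.
by rewrite -/(unsplit (inr u)) unsplitK.
Qed.

Lemma copy_eq (u v : 'I_n) i j : (copy u i == copy v j) = (u == v) && (i == j).
Proof.
apply/eqP/andP => [h|[/eqP-> /eqP->] //].
by rewrite -(copy_base u i) -{2}(copy_layer u i) h copy_base copy_layer !eqxx.
Qed.

Definition swap_copies_fun (a : 'I_(n + n)) := copy (base a) (~~ layer a).

Lemma swap_copies_inj : injective swap_copies_fun.
Proof.
apply: (can_inj (g := swap_copies_fun)) => a.
by rewrite /swap_copies_fun copy_base copy_layer negbK copyK.
Qed.

Definition swap_copies : 'S_(n + n) := perm swap_copies_inj.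

Lemma swap_copiesE u i : swap_copies (copy u i) = copy u (~~ i).
Proof. by rewrite permE /swap_copies_fun copy_base copy_layer. Qed.

(** Twin-freeness makes [s] map pairs of copies to pairs of copies; the map [t] so induced on the
    vertices of [G] is an automorphism. *)
Lemma automorphism_fixes_base (G : sgraph n) (s : 'S_(n + n)) :
    asymmetric G ->
    (forall a b, closed_adj G (base (s a)) (base (s b)) =
                 closed_adj G (base a) (base b)) ->
  forall a, base (s a) = base a.
Proof.
move=> hG hs.
have base_eq a b : base a = base b -> base (s a) = base (s b).
  move=> hab; apply: (asymmetric_closed_twin_free hG) => w.
  (* As [s] is onto, [w] is the base of an image, so [hs] applies. *)
  rewrite -(copy_base w true) -(permKV s (copy w true)).
  by rewrite !hs hab.
pose t u := base (s (copy u false)).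
have tE a : base (s a) = t (base a) by apply: base_eq; rewrite copy_base.
have cl_t u v : closed_adj G (t u) (t v) = closed_adj G u v.
  by rewrite hs !copy_base.
have t_inj : injective t.
  (* Vertices with the same image under [t] are closed twins, by [cl_t]. *)
  move=> u v huv; apply: (asymmetric_closed_twin_free hG) => w.
  by rewrite -cl_t huv cl_t.
have /hG h : automorphism G (perm t_inj).
  by move=> u v; rewrite !adj_closed_adj (inj_eq perm_inj) !permE cl_t.
by move=> a; rewrite tE -(permE t_inj) h perm1.
Qed.

Lemma perm_fixing_base (s : 'S_(n + n)) u i :
    (forall a, base (s a) = base a) ->
  s (copy u i) = copy u (i (+) layer (s (copy u false))).
Proof.
move=> hs.
have sE j : s (copy u j) = copy u (layer (s (copy u j))).
  by rewrite -{1}(copyK (s _)) hs copy_base.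
case: i; last exact: sE.
rewrite {1}sE; congr copy.
have : layer (s (copy u true)) != layer (s (copy u false)).
  apply: contraTneq isT => h; have : copy u true == copy u false.
    by rewrite -(inj_eq (@perm_inj _ s)) sE h -sE.
  by rewrite copy_eq andbF.
by case: layer; case: layer.
Qed.

End Copies.

(** * Entrywise forms of switching and of switching isomorphism *)

Section GainMatrices.
Variable R : realType.
Local Notation C := R[i].

Lemma unit_norm_neq0 (x : C) : `|x| = 1 -> x != 0.
Proof. by move=> h; rewrite -normr_eq0 h oner_eq0. Qed.

Lemma conj_unit_norm (x : C) : `|x| = 1 -> Num.conj x = x^-1.
Proof. by move=> h; rewrite invC_norm h expr1n invr1 mul1r. Qed.

Lemma switching_mx_diag m (x : 'I_m -> C) :
  (forall u, `|x u| = 1) -> is_switching_mx (diag_mx (\row_u x u)).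
Proof.
move=> hx; split; first exact: diag_mx_is_diag.
by move=> u; rewrite !mxE eqxx mulr1n.
Qed.

Lemma switch_mxE m (X A : 'M[C]_m) u v :
  is_switching_mx X -> switch_mx X A u v = X u u * A u v / X v v.
Proof.
move=> [/diag_mxP [x ->] hX].
have x0 w : x 0 w != 0 by have := unit_norm_neq0 (hX w); rewrite !mxE eqxx.
have hinv : invmx (diag_mx x) = diag_mx (\row_w (x 0 w)^-1).
  have hu : diag_mx x \in unitmx.
    by rewrite unitmxE det_diag unitfE; apply/prodf_neq0.
  rewrite -[RHS](mulKmx hu) mulmx_diag.
  suff -> : \row_j (x 0 j * (\row_w (x 0 w)^-1) 0 j) = const_mx 1.
    by rewrite diag_const_mx mulmx1.
  by apply/rowP => w; rewrite !mxE divff.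
by rewrite /switch_mx hinv mul_mx_diag mul_diag_mx !mxE !eqxx !mulr1n.
Qed.

Lemma perm_mx_conjE m (s : 'S_m) (A : 'M[C]_m) u v :
  (perm_mx s *m A *m invmx (perm_mx s)) u v = A (s u) (s v).
Proof.
have -> : invmx (perm_mx s) = perm_mx s^-1 :> 'M[C]_m.
  rewrite -[RHS](mulKmx (unitmx_perm _ s)) -perm_mxM mulgV perm_mx1.
  by rewrite mulmx1.
by rewrite -row_permE -col_permE !mxE.
Qed.

(** Serves both for the optional converse and for the choice between [z] and its conjugate, so that
    the two compose by exclusive or. *)
Definition conj_if (b : bool) (x : C) := if b then Num.conj x else x.

Lemma conj_mxE m (A : 'M[C]_m) u v : conj_mx A u v = Num.conj (A u v).
Proof. exact: mxE. Qed.

Lemma conj_if_sign b (c : bool) (x : C) :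
  conj_if b ((-1) ^+ c * x) = (-1) ^+ c * conj_if b x.
Proof. by case: b; rewrite //= rmorphM rmorphXn rmorphN1. Qed.

Lemma conj_if_eq0 b x : (conj_if b x == 0) = (x == 0).
Proof. by case: b; rewrite //= conjC_eq0. Qed.

(** The switching is moved outside the converse and the relabelling, which conjugate and permute the
    entries of [X]. *)
Lemma switching_isomorphicP m (Psi Psi' : gain_graph R m) :
  switching_isomorphic Psi Psi' <->
  exists (y : 'I_m -> C) (b : bool) (s : 'S_m), (forall u, `|y u| = 1) /\
    forall u v, gain_mx Psi' u v =
      y u * conj_if b (gain_mx Psi (s u) (s v)) / y v.
Proof.
split=> [[X [b [s [hX /= h]]]]|[y [b [s [hy h]]]]].
- exists (fun u => conj_if b (X (s u) (s u))), b, s; split.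
    by move=> u; have [_ hn] := hX; rewrite /conj_if; case: b {h} => //; rewrite norm_conjC.
  move=> u v; rewrite h perm_mx_conjE /conj_if; case: b {h}.
    by rewrite conj_mxE switch_mxE // rmorphM rmorphM fmorphV.
  by rewrite switch_mxE.
- pose x u := conj_if b (y (s^-1 u)%g).
  have hx u : `|x u| = 1 by rewrite /x; case: b {h x} => /=; rewrite ?norm_conjC.
  exists (diag_mx (\row_u x u)), b, s; split; first exact: switching_mx_diag.
  apply/matrixP => u v; rewrite /= perm_mx_conjE h.
  have := switching_mx_diag hx; rewrite /x {h x hx}; case: b => hX.
    rewrite conj_mxE switch_mxE // !mxE !eqxx !mulr1n !permK.
    by rewrite rmorphM rmorphM fmorphV /= !conjCK.
  by rewrite switch_mxE // !mxE !eqxx !mulr1n !permK.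
Qed.

Lemma switch_signedP m (Psi : gain_graph R m) :
  (exists2 Sigma : gain_graph R m,
     signed_graph Sigma & switching_equivalent Psi Sigma) <->
  (exists2 X : 'M[C]_m, is_switching_mx X &
     forall u v, switch_mx X (gain_mx Psi) u v \in [:: -1; 0; 1]).
Proof.
split=> [[Sigma hS [X hX h]]|[X hX h]].
  exists X => // u v; rewrite -h mxE !inE; case: ifP => [/hS [] ->|_];
    by rewrite eqxx ?orbT.
have [_ hn] := hX.
pose g u v := X u u * gain Psi u v / X v v.
have g1 u v : adj (underlying Psi) u v -> `|g u v| = 1.
  by move=> huv; rewrite !normrM normfV !hn gain_norm1 // invr1 !mulr1.
have gV u v : adj (underlying Psi) u v -> g v u = (g u v)^-1.
  by move=> huv; rewrite /g (gainV huv) !invfM invrK; ring.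
have gE : gain_mx (GainGraph g1 gV) = switch_mx X (gain_mx Psi).
  apply/matrixP => u v; rewrite switch_mxE // !mxE /=; case: ifP => //.
  by rewrite mulr0 mul0r.
exists (GainGraph g1 gV); last by exists X.
move=> u v huv; have := h u v; rewrite -gE mxE huv !inE.
(* On an edge the value [0] is excluded. *)
have := unit_norm_neq0 (gain_norm1 huv); rewrite /=.
by move/negbTE => -> /= /orP[] /eqP; [right|left].
Qed.

End GainMatrices.

(** * The doubled gain graph *)

Section Breve.
Variables (R : realType) (n : nat) (Psi : gain_graph R n) (z : R[i]).
Local Notation A := (gain_mx Psi).
Local Notation B := (breve_mx A z).

Lemma gain_mx_neq0 u v : (A u v != 0) = adj (underlying Psi) u v.
Proof.
rewrite mxE; case: ifP => [h|]; last by rewrite eqxx.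
by rewrite (unit_norm_neq0 (gain_norm1 h)).
Qed.

Lemma gain_mx_diag u : A u u = 0.
Proof. by rewrite mxE adj_irr. Qed.

Lemma breve_mx_copy u i v j : u != v ->
  B (copy u i) (copy v j) = (-1) ^+ (i && j) * A u v.
Proof.
move=> /negbTE huv; rewrite /copy /breve_mx; case: i; case: j => /=;
  rewrite ?block_mxEul ?block_mxEur ?block_mxEdl ?block_mxEdr
    ?expr1 ?expr0 ?mulN1r ?mul1r //; first by rewrite mxE.
all: by rewrite mxE [X in _ + X]mxE huv addr0.
Qed.

Lemma breve_mx_same u i j :
  B (copy u i) (copy u j) =
    if i == j then 0 else conj_if i z.
Proof.
rewrite /copy /breve_mx; case: i; case: j => /=;
  rewrite ?block_mxEul ?block_mxEur ?block_mxEdl ?block_mxEdr.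
- by rewrite mxE gain_mx_diag oppr0.
- by rewrite mxE gain_mx_diag add0r mxE eqxx.
- by rewrite mxE gain_mx_diag add0r mxE eqxx.
- by rewrite gain_mx_diag.
Qed.

(** The underlying graph is the strong product of that of [Psi] with a single edge. *)
Lemma breve_mx_support a b : z != 0 ->
  (a == b) || (B a b != 0) = closed_adj (underlying Psi) (base a) (base b).
Proof.
move=> z0; rewrite -(copyK a) -(copyK b) !copy_base copy_eq /closed_adj.
case: eqVneq => [->|huv] /=; last first.
  by rewrite breve_mx_copy // mulf_eq0 signr_eq0 /= gain_mx_neq0.
by rewrite breve_mx_same; case: eqP => //= _; rewrite conj_if_eq0.
Qed.

Hypothesis hz : `|z| = 1.

Lemma sign_symmetric_of_signed :
  (exists2 X : 'M[R[i]]_n, is_switching_mx X &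
     forall u v, switch_mx X A u v \in [:: -1; 0; 1]) ->
  sign_symmetric (breve Psi hz).
Proof.
move=> [X hX h]; have [_ hn] := hX; apply/switching_isomorphicP.
have X0 u := unit_norm_neq0 (hn u).
(* The factor [X ^- 2] undoes the effect of the converse on [A]. The signs match because
   [(1 + i) (1 + j) + i + j] and [i j + 1] agree modulo 2. *)
exists (fun a => (-1) ^+ layer a * (X (base a) (base a)) ^- 2), true, swap_copies.
split=> [a|a b].
  by rewrite normrM normrX normrN1 expr1n mul1r normfV normrX hn expr1n invr1.
rewrite gain_mx_neg gain_mx_breve mxE -(copyK a) -(copyK b).
move: (base a) (base b) (layer a) (layer b) => u v i j.
rewrite !swap_copiesE !copy_base !copy_layer.
have [<-|huv] := eqVneq u v.
  rewrite !breve_mx_same; case: i; case: j => /=;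
    rewrite ?conjC0 ?expr1 ?expr0 ?conjCK; field; exact: X0.
rewrite !breve_mx_copy // conj_if_sign /=.
(* The switched entry is real; solve this for the conjugate of [A u v]. *)
have hA : Num.conj (A u v) = X u u ^+ 2 * A u v / X v v ^+ 2.
  have : Num.conj (switch_mx X A u v) = switch_mx X A u v.
    have := h u v; rewrite !inE => /or3P[] /eqP ->;
      by rewrite ?rmorphN1 ?conjC0 ?conjC1.
  rewrite !switch_mxE // rmorphM rmorphM fmorphV /= !(conj_unit_norm (hn _)) invrK.
  move=> e.
  have -> : Num.conj (A u v) = X u u * ((X u u)^-1 * Num.conj (A u v) * X v v) / X v v.
    by field; rewrite !X0.
  by rewrite e; field; rewrite !X0.
rewrite hA; case: i; case: j => /=; rewrite ?expr1 ?expr0; field; by rewrite !X0.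
Qed.

Hypothesis hasym : asymmetric (underlying Psi).
Hypothesis hz4 : z ^+ 4 <> 1.

Lemma signed_of_sign_symmetric :
  sign_symmetric (breve Psi hz) ->
  exists2 X : 'M[R[i]]_n, is_switching_mx X &
    forall u v, switch_mx X A u v \in [:: -1; 0; 1].
Proof.
move=> /switching_isomorphicP [y [c [s [hy]]]].
rewrite gain_mx_neg gain_mx_breve => hB.
have y0 a := unit_norm_neq0 (hy a).
have z0 := unit_norm_neq0 hz.
have s_base : forall a, base (s a) = base a.
  apply: (automorphism_fixes_base hasym) => a b.
  (* Negation, conjugation and switching keep nonzero entries nonzero, so [s] preserves the
     support. *)
  rewrite -!(breve_mx_support _ _ z0) (inj_eq perm_inj); congr (_ || ~~ _).
  have := congr1 (eq_op^~ 0) (hB a b).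
  rewrite mxE oppr_eq0 !mulf_eq0 invr_eq0 (negbTE (y0 a)) (negbTE (y0 b)).
  by rewrite orbF conj_if_eq0.
pose e u := layer (s (copy u false)).
have sE u i : s (copy u i) = copy u (i (+) e u) by exact: perm_fixing_base.
have adj_neq u v : adj (underlying Psi) u v -> u != v.
  by rewrite adj_closed_adj => /andP[].
have edge u v i j : adj (underlying Psi) u v ->
    - ((-1) ^+ (i && j) * A u v) = y (copy u i) *
      ((-1) ^+ ((i (+) e u) && (j (+) e v)) * conj_if c (A u v)) / y (copy v j).
  move=> huv; have := hB (copy u i) (copy v j).
  by rewrite mxE !sE !breve_mx_copy ?adj_neq // conj_if_sign.
have ratio u v : adj (underlying Psi) u v ->
    y (copy u false) = (-1) ^+ e v * y (copy u true).
  (* Both edges end in layer [false] and so have gain [A u v]; their images have signs whose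
     exponents, [e u && e v] and [~~ e u && e v], add up to [e v]. *)
  move=> huv; have := edge u v true false huv; rewrite (edge u v false false huv).
  have hA : conj_if c (A u v) != 0 by rewrite conj_if_eq0 gain_mx_neq0.
  have yv0 : (y (copy v false))^-1 != 0 by rewrite invr_eq0.
  move/(mulIf yv0); rewrite !mulrA => /(mulIf hA).
  by case: (e u); case: (e v); rewrite /= ?expr1 ?expr0 ?mulr1 ?mulrN1 ?mul1r ?mulN1r
    // => /eqP; rewrite ?eqr_oppLR // => /eqP.
have twin u v : adj (underlying Psi) u v -> e u = c /\ e v.
  move=> huv.
  have : - z = (-1) ^+ e v * conj_if (c (+) e u) z.
    have := hB (copy u false) (copy u true).
    rewrite mxE !sE !breve_mx_same (ratio _ _ huv) /=.
    have -> : (e u == ~~ e u) = false by case: (e u).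
    have -> : conj_if c (conj_if (e u) z) = conj_if (c (+) e u) z.
      by move: (e u) => []; case: (c); rewrite /= ?conjCK.
    by move=> ->; rewrite mulrAC mulfK.
  (* If [c = e u], the conjugations cancel and [- z = (-1) ^ e v * z] forces [e v]. Otherwise [- z]
     is [z^-1] up to sign, whence [z ^ 4 = 1]. *)
  case: (altP (c =P e u)) => [<-|].
    rewrite addbb /=; case: (e v) => // /eqP.
    by rewrite expr0 mul1r eq_sym -addr_eq0 -mulr2n mulrn_eq0 (negbTE z0).
  move=> hcu; have -> : c (+) e u = true by move: hcu; case: (c); case: (e u).
  rewrite /= (conj_unit_norm hz) => h; case: hz4.
  have : z ^+ 2 = - (-1) ^+ e v.
    by rewrite expr2 -[X in X * _]opprK h mulNr -mulrA mulVf // mulr1.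
  by rewrite (exprM z 2 2) => ->; rewrite sqrrN sqrr_sign.
have gain_sq u v : adj (underlying Psi) u v ->
    A u v ^+ 2 = y (copy u false) / y (copy v false).
  move=> huv.
  have [eu ev] := twin _ _ huv.
  (* The reversed edge yields [e u], and then [c]. *)
  have [_ eu1] : e v = c /\ e u by apply: twin; rewrite adj_sym.
  have := edge u v false false huv; rewrite eu1 ev -eu eu1 /= expr0 expr1 mul1r.
  have hAn : `|A u v| = 1 by rewrite mxE huv gain_norm1.
  rewrite (conj_unit_norm hAn) => h.
  rewrite expr2 -[X in X * _]opprK h.
  by field; rewrite y0 (unit_norm_neq0 hAn).
(* Any choice of square roots works: another one only changes signs of switched entries. *)
pose x u := (sqrtC (y (copy u false)))^-1.
have hx u : `|x u| = 1.
  rewrite normfV norm_rootC.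
  by rewrite hy sqrtC1 invr1.
have x2 u : x u ^+ 2 = (y (copy u false))^-1 by rewrite exprVn sqrtCK.
exists (diag_mx (\row_u x u)); first exact: switching_mx_diag.
move=> u v; rewrite (switch_mxE _ _ _ (switching_mx_diag hx)).
have xE w : diag_mx (\row_u x u) w w = x w by rewrite !mxE eqxx mulr1n.
rewrite !xE !inE; have [huv|] := boolP (adj (underlying Psi) u v); last first.
  by rewrite -gain_mx_neq0 negbK => /eqP->; rewrite mulr0 mul0r eqxx orbT.
(* By [gain_sq] the factors [y] cancel in the square, which leaves only [1] and [-1] for the
   entry. *)
have : (x u * A u v / x v) ^+ 2 == 1.
  rewrite !exprMn x2 (exprVn (x v)) x2 gain_sq // invrK; apply/eqP.
  by field; rewrite !y0.
by rewrite sqrf_eq1 => /orP[] /eqP->; rewrite eqxx ?orbT.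
Qed.

End Breve.

Theorem theorem4p5 (R : realType) (n : nat) (Psi : gain_graph R n) (z : R[i])
    (hconn : connected (underlying Psi))
    (hnbip : ~ bipartite (underlying Psi))
    (hasym : asymmetric (underlying Psi))
    (hz : `|z| = 1)
    (hz4 : z ^+ 4 <> 1) :
  (sign_symmetric (breve Psi hz) <->
     exists2 Sigma : gain_graph R n,
       signed_graph Sigma & switching_equivalent Psi Sigma)
  /\
  (sign_symmetric (breve Psi hz) <->
     exists2 X : 'M[R[i]]_n,
       is_switching_mx X &
       forall u v : 'I_n,
         switch_mx X (gain_mx Psi) u v \in [:: -1; 0; 1]).
Proof.
have hX : _ <-> _ := conj (signed_of_sign_symmetric hasym hz4)
                          (@sign_symmetric_of_signed _ _ Psi _ hz).
by split; last exact: hX; rewrite hX switch_signedP.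
Qed.
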